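(* If $G$ is a $(P_3\cup P_2)$-free graph, then $\gamma_s(G) \le \alpha(G)+1$.
   Context: All graphs are finite, simple and undirected (and not necessarily connected). $P_n$ denotes the path on $n$ vertices, and $G_1\cup G_2$ denotes the disjoint union of vertex-disjoint graphs $G_1$ and $G_2$. For a graph $H$, a graph is $H$-free if it has no induced subgraph isomorphic to $H$. A set $S\subseteq V(G)$ is a dominating set of $G$ if every vertex of $V(G)\setminus S$ is adjacent to at least one vertex of $S$. A secure dominating set of $G$ is a dominating set $S$ of $G$ such that for every $v\in V(G)\setminus S$ there is a neighbor $u$ of $v$ in $S$ such that $(S\setminus\{u\})\cup\{v\}$ is a dominating set of $G$. The secure domination number $\gamma_s(G)$ is the minimum cardinality of a secure dominating set of $G$, and the independence number $\alpha(G)$ is the maximum cardinality of an independent set of $G$. *)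

(* Defs.v *)
From mathcomp Require Import all_boot.
Set Implicit Arguments.
Unset Strict Implicit.
Unset Printing Implicit Defensive.

Record sgraph : Type := SGraph {
  vertex :> finType;
  adj : rel vertex;
  adj_sym : symmetric adj;
  adj_irrefl : irreflexive adj
}.

Definition giso (G H : sgraph) : Prop :=
  exists2 f : G -> H, bijective f & forall x y, adj (f x) (f y) = adj x y.

Section Induced.
Variables (G : sgraph) (A : {set G}).
Definition induced_adj : rel {x : G | x \in A} :=
  fun x y => adj (val x) (val y).
Lemma induced_sym : symmetric induced_adj.
Proof. by move=> x y; apply: adj_sym. Qed.
Lemma induced_irrefl : irreflexive induced_adj.
Proof. by move=> x; apply: adj_irrefl. Qed.
Definition induced : sgraph := SGraph induced_sym induced_irrefl.
End Induced.

Definition graph_free (H G : sgraph) : Prop :=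
  ~ exists A : {set G}, giso (induced A) H.

Section PathGraph.
Variable n : nat.
Definition path_adj : rel 'I_n := fun i j => (i.+1 == j) || (j.+1 == i).
Lemma path_adj_sym : symmetric path_adj.
Proof. by move=> i j; apply: orbC. Qed.
Lemma path_adj_irrefl : irreflexive path_adj.
Proof. by move=> i; rewrite /path_adj orbb gtn_eqF. Qed.
Definition path_graph : sgraph := SGraph path_adj_sym path_adj_irrefl.
End PathGraph.

Section DisjointUnion.
Variables G1 G2 : sgraph.
Definition dunion_adj : rel (G1 + G2)%type := fun x y =>
  match x, y with
  | inl a, inl b => adj a b
  | inr a, inr b => adj a b
  | _, _ => false
  end.
Lemma dunion_sym : symmetric dunion_adj.
Proof. by move=> [x|x] [y|y] //=; apply: adj_sym. Qed.
Lemma dunion_irrefl : irreflexive dunion_adj.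
Proof. by move=> [x|x] /=; apply: adj_irrefl. Qed.
Definition dunion : sgraph := SGraph dunion_sym dunion_irrefl.
End DisjointUnion.

Section Domination.
Variable G : sgraph.
Implicit Type S : {set G}.

Definition dominating S : bool :=
  [forall v, (v \notin S) ==> [exists u, (u \in S) && adj v u]].

Definition secure_dominating S : bool :=
  dominating S &&
  [forall v, (v \notin S) ==>
     [exists u, [&& u \in S, adj v u & dominating ((S :\ u) :|: [set v])]]].

Lemma secure_dominatingT : secure_dominating [set: G].
Proof. by apply/andP; split; apply/forallP => v; rewrite inE. Qed.

Definition independent S : bool :=
  [forall u in S, forall v in S, ~~ adj u v].

(* A genuine minimum: the default value [set: G] is itself a candidate, by
   secure_dominatingT. *)
Definition secure_domination_number : nat :=
  #|[arg min_(S < [set: G] | secure_dominating S) #|S|]|.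

Definition independence_number : nat := \max_(S | independent S) #|S|.

End Domination.

(* Main.v *)
Require Import Defs.
From mathcomp Require Import all_boot.

(** Let [I] be a maximum independent set. It dominates [G], and a vertex [v]
    outside [I] fails to be defended by a neighbour [u] in [I] exactly when
    [u] has a private neighbour [w] (one whose only neighbour in [I] is [u])
    that differs from [v] and is not adjacent to it. If every vertex outside
    [I] is defended, [I] is secure. Otherwise one vertex is added to [I]: an
    undefended [v] with as few neighbours in [I] as possible. The claim is
    that [v |: I] is secure, so that the secure domination number is at most
    [alpha + 1].

    Suppose that some [v'] is not defended in [v |: I]. It is not adjacent to
    [v], since no vertex outside [v |: I] depends on [v] alone for its
    domination, so that the guard of [v] can move freely. Hence every [u] in
    [I] adjacent to [v'] has a private neighbour [w u] adjacent to neither [v]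
    nor [v']. Since [v] has at least two neighbours in [I]
    ([undefended_two_nbrs]), freeness gives that the neighbours of [v'] in
    [I] are among those of [v] ([far_private_adj]), and the choice of [v]
    makes the two sets of neighbours equal; call the set [U].

    Two exchanges now contradict the maximality of [I] ([exchange]). If the
    [w u] are pairwise nonadjacent, [U] can be replaced by all of them
    together with [v']. Otherwise [w a] and [w b] are adjacent for some [a]
    and [b] in [U]; a third [u] in [U] would yield the forbidden graph formed
    by the path [v, u, v'] and the edge [w a, w b], so [U] is [{a, b}], and it
    can be replaced by [v], [v'] and [w a]. *)

Set Implicit Arguments.
Unset Strict Implicit.
Unset Printing Implicit Defensive.

(** * Induced subgraphs *)

Lemma embedding_not_free (H G : sgraph) (g : H -> G) :
  injective g -> (forall x y, adj (g x) (g y) = adj x y) -> ~ graph_free H G.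
Proof.
move=> g_inj g_adj; apply; exists (g @: [set: H]).
pose h (x : H) : induced (g @: [set: H]) :=
  exist (fun y => y \in g @: [set: H]) (g x) (imset_f g (in_setT x)).
have h_inj : injective h by move=> x y /(congr1 val) /g_inj.
have h_card : #|induced (g @: [set: H])| <= #|H|.
  by rewrite card_sig -[leqRHS]cardsT; apply: leq_imset_card.
have [f hK fK] := inj_card_bij h_inj h_card.
exists f; first by exists h.
by move=> x y; rewrite -[in RHS](fK x) -[in RHS](fK y) -g_adj.
Qed.

(** The disjointness of the path from the edge, and most of the distinctness
    within them, follows from the adjacencies: only the two ends of the path
    have to be separated explicitly. *)
Lemma P3_P2_free_adj (G : sgraph) (x y z p q : G) :
  graph_free (dunion (path_graph 3) (path_graph 2)) G ->
  adj x y -> adj y z -> x != z -> ~~ adj x z -> adj p q ->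
  ~~ allrel (fun s t => ~~ adj s t) [:: x; y; z] [:: p; q].
Proof.
move=> free xy yz xz nxz pq; apply/negP => /=.
rewrite /allrel /= !andbT => /and3P[/andP[xp xq] /andP[yp yq] /andP[zp zq]].
pose g (i : dunion (path_graph 3) (path_graph 2)) : G :=
  match i with
  | inl i => nth x [:: x; y; z] i
  | inr i => nth p [:: p; q] i
  end.
have sN (s t : G) b : adj s t = b -> adj t s = b by rewrite adj_sym.
move: (negbTE nxz) (negbTE xp) (negbTE xq) (negbTE yp) (negbTE yq)
  (negbTE zp) (negbTE zq) => {nxz xp xq yp yq zp zq} nxz xp xq yp yq zp zq.
have g_adj i j : adj (g i) (g j) = adj i j.
  case: i j => [[[|[|[|i]]] lti]|[[|[|i]] lti]] //
    [[[|[|[|j]]] ltj]|[[|[|j]] ltj]] //=;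
  by rewrite ?adj_irrefl //; (assumption || (apply: sN; assumption)).
apply: (embedding_not_free _ g_adj free).
(* Distinct vertices of the pattern are told apart by their neighbourhoods,
   except for the two ends of the path. *)
move=> i j gij.
have same k : adj i k = adj j k by rewrite -!g_adj gij.
case: i j gij same => [[[|[|[|i]]] lti]|[[|[|i]] lti]] //
    [[[|[|[|j]]] ltj]|[[|[|j]] ltj]] //= gij same;
  try (by congr inl; apply: val_inj); try (by congr inr; apply: val_inj);
  try (by rewrite gij eqxx in xz);
  try (by have := same (inl (Ordinal (isT : 0 < 3))));
  try (by have := same (inl (Ordinal (isT : 1 < 3))));
  try (by have := same (inr (Ordinal (isT : 0 < 2))));
  try (by have := same (inr (Ordinal (isT : 1 < 2)))).
Qed.

(** * Guards and the vertices that block them *)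

Section SecureDomination.
Variable G : sgraph.
Implicit Types (S T X I : {set G}) (u v w : G).

Definition nbrs S v := [set u in S | adj v u].

Lemma nbrsP S v u : reflect (u \in S /\ adj v u) (u \in nbrs S v).
Proof. by rewrite inE; apply: andP. Qed.

Lemma dominatingP S :
  reflect (forall v, v \notin S -> exists u, u \in nbrs S v) (dominating S).
Proof.
apply: (iffP forallP) => [dom v vS | dom v].
  by have /existsP[u uP] := implyP (dom v) vS; exists u; rewrite inE.
by apply/implyP => /dom[u uP]; apply/existsP; exists u; rewrite inE in uP.
Qed.

Lemma independentP S :
  reflect {in S &, forall u v, ~~ adj u v} (independent S).
Proof.
apply: (iffP forall_inP) => [ind u v uS vS | ind u uS].
  exact: (forall_inP (ind u uS)).
by apply/forall_inP => v; apply: ind.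
Qed.

(** The guard of [u] cannot move to [v] because [w] would be left undominated:
    [u] is the only guard next to [w]. *)
Definition blocks S v u w :=
  [&& w \notin S, nbrs S w == [set u], w != v & ~~ adj v w].

Definition undefended S v :=
  (v \notin S) && [forall u in nbrs S v, exists w, blocks S v u w].

Lemma undefendedP S v :
  reflect (v \notin S /\ forall u, u \in nbrs S v -> exists w, blocks S v u w)
          (undefended S v).
Proof.
apply: (iffP andP) => -[vS bl]; split=> //.
  by move=> u /(forall_inP bl)/existsP.
by apply/forall_inP => u /bl/existsP.
Qed.

Lemma not_dominating_swap S u v : dominating S -> v \notin S ->
  u \in nbrs S v -> ~~ dominating ((S :\ u) :|: [set v]) ->
  exists w, blocks S v u w.
Proof.
move=> /dominatingP dom vS /nbrsP[uS vu] /forallPn[w].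
rewrite negb_imply !inE negb_or => /andP[/andP[wSu wv] /existsPn nw].
have nvw : ~~ adj v w.
  by have := nw v; rewrite !inE eqxx orbT /= adj_sym.
have wu : w != u by apply: contraNneq nvw => ->.
have wS : w \notin S by move: wSu; rewrite wu.
have onlyu z : z \in nbrs S w -> z = u.
  move=> /nbrsP[zS wz]; apply/eqP; apply: contraT => zu.
  by have := nw z; rewrite !inE zu zS wz.
exists w; rewrite /blocks wS wv nvw !andbT.
apply/eqP/setP => z; rewrite in_set1.
apply/idP/eqP => [/onlyu // | ->].
by have [t tw] := dom _ wS; rewrite -(onlyu t tw).
Qed.

Lemma dominating_secure S : dominating S -> (forall v, ~~ undefended S v) ->
  secure_dominating S.
Proof.
move=> dom def; rewrite /secure_dominating dom; apply/forallP => v.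
apply/implyP => vS; apply: contraR (def v) => /existsPn nodef.
apply/undefendedP; split=> // u uv; apply: not_dominating_swap => //.
by have := nodef u; have /nbrsP[-> ->] := uv.
Qed.

Lemma secure_domination_number_le S :
  secure_dominating S -> secure_domination_number G <= #|S|.
Proof.
rewrite /secure_domination_number; case: arg_minnP => [|T _ minT /minT //].
exact: secure_dominatingT.
Qed.

Lemma leq_independence_number S :
  independent S -> #|S| <= independence_number G.
Proof. by move=> indS; apply: (bigmax_sup S). Qed.

Lemma max_independent :
  exists2 I : {set G}, independent I & #|I| = independence_number G.
Proof.
have ind0 : independent (set0 : {set G}).
  by apply/independentP => u v; rewrite inE.
have [|I indI cardI] := @eq_bigmax_cond _ (@independent G) (fun S => #|S|).
  by apply/card_gt0P; exists set0.
by exists I.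
Qed.

(** * Maximum independent sets *)

Section MaximumIndependent.
Variable I : {set G}.
Hypotheses (indI : independent I) (maxI : #|I| = independence_number G).

(** Otherwise replacing [X] by [T] in [I] would give a larger independent
    set. *)
Lemma exchange T X : independent T -> [disjoint T & I] ->
  X \subset I -> {in T, forall t, nbrs I t \subset X} -> #|T| <= #|X|.
Proof.
move=> /independentP indT TI XI nT.
have TIX t s : t \in T -> s \in I :\: X -> ~~ adj t s.
  move=> tT /setDP[sI sX]; apply: contra sX => ts.
  by apply: (subsetP (nT t tT)); apply/nbrsP.
have : independent (T :|: (I :\: X)).
  apply/independentP => u v /setUP[uT|uI] /setUP[vT|vI].
  - exact: indT.
  - exact: TIX.
  - by rewrite adj_sym; apply: TIX.
  - by move: uI vI => /setDP[uI _] /setDP[vI _]; apply: (independentP _ indI).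
move=> /leq_independence_number; rewrite -maxI cardsU.
have -> : T :&: (I :\: X) = set0.
  apply/eqP; rewrite setI_eq0; apply: disjointWr TI; exact: subsetDl.
rewrite cards0 subn0 cardsD (setIidPr XI).
rewrite addnBA; last exact: subset_leq_card.
by rewrite leq_subLR leq_add2r.
Qed.

Lemma max_independent_dominating : dominating I.
Proof.
apply/dominatingP => v vI; apply/set0Pn; apply/negP => /eqP nv0.
have : #|[set v]| <= #|set0 : {set G}|.
  apply: exchange; rewrite ?sub0set //.
  - by apply/independentP => x y /set1P-> /set1P->; rewrite adj_irrefl.
  - by rewrite disjoints1.
  - by move=> t /set1P->; rewrite nv0.
by rewrite cards1 cards0.
Qed.

(** If [u] were the only neighbour of [v] in [I], then [v] and the vertex that
    blocks it could replace [u]. *)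
Lemma undefended_two_nbrs v : undefended I v ->
  exists a b, [/\ a \in nbrs I v, b \in nbrs I v & a != b].
Proof.
move=> /undefendedP[vI bl].
have [a av] := dominatingP _ max_independent_dominating v vI.
have [eqa|] := eqVneq (nbrs I v) [set a]; last first.
  rewrite eqEsubset sub1set av andbT => /subsetPn[b bv].
  by rewrite in_set1 eq_sym; exists a, b.
have [w /and4P[wI /eqP nw wv nvw]] := bl a av.
have /nbrsP[aI _] := av.
have : #|[set v; w]| <= #|[set a]|.
  apply: exchange; rewrite ?sub1set //.
  - apply/independentP => x y /set2P[]-> /set2P[]->; rewrite ?adj_irrefl //.
    by rewrite adj_sym.
  - apply/pred0Pn => -[x /= /andP[/set2P[]-> xI]]; first by rewrite xI in vI.
    by rewrite xI in wI.
  - by move=> t /set2P[]->; rewrite ?eqa ?nw.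
by rewrite cards2 cards1 eq_sym wv.
Qed.

Hypothesis free : graph_free (dunion (path_graph 3) (path_graph 2)) G.

(** Two neighbours of [v] in [I] form a path with centre [v]. Of all the
    possible adjacencies between this path and the edge [x w], only that of
    [v] and [w] is compatible with the independence of [I] and with [w] being
    private to [x]. *)
Lemma far_private_adj v x w : undefended I v ->
  x \in I -> x \notin nbrs I v -> nbrs I w = [set x] -> adj v w.
Proof.
move=> und xI xv nw; have /nbrsP[_ wx] : x \in nbrs I w by rewrite nw set11.
have nvx : ~~ adj v x by apply: contra xv => vx; apply/nbrsP.
have [a [b [av bv ab]]] := undefended_two_nbrs und.
have notw z : z \in nbrs I v -> [/\ z \in I, adj v z & ~~ adj z w].
  move=> zv; have /nbrsP[zI vz] := zv; split=> //.
  apply: contra xv => zw; suff /set1P <- : z \in [set x] by [].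
  by rewrite -nw; apply/nbrsP; rewrite adj_sym.
have [[aI va naw] [bI vb nbw]] := (notw a av, notw b bv).
have ind := independentP _ indI.
have xw : adj x w by rewrite adj_sym.
have av' : adj a v by rewrite adj_sym.
have := P3_P2_free_adj free av' vb ab (ind a b aI bI) xw.
by rewrite /allrel /= nvx naw nbw (ind a x) // (ind b x) //= !andbT negbK.
Qed.

(** Since [I] already dominates, no vertex outside [v |: I] has [v] as its only
    guard; so an undefended vertex is not adjacent to [v], and what blocks it
    is a private neighbour with respect to [I] that [v] does not see. *)
Lemma undefended_add v v' : v \notin I -> undefended (v |: I) v' ->
  [/\ v' \notin I, v' != v, ~~ adj v v' &
    forall u, u \in nbrs I v' -> exists2 w, blocks I v' u w & ~~ adj v w].
Proof.
move=> vI /undefendedP[]; rewrite in_setU1 negb_or => /andP[v'v v'I] bl.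
split=> // [|u /nbrsP[uI v'u]].
  apply/negP => vv'.
  have [|w /and4P[]] := bl v; first by apply/nbrsP; rewrite setU11 adj_sym.
  rewrite in_setU1 negb_or => /andP[_ wI] /eqP nw _ _.
  have [z /nbrsP[zI wz]] := dominatingP _ max_independent_dominating w wI.
  have /set1P zv : z \in [set v] by rewrite -nw; apply/nbrsP; rewrite setU1r.
  by rewrite -zv zI in vI.
have [|w /and4P[]] := bl u; first by apply/nbrsP; rewrite setU1r.
rewrite in_setU1 negb_or => /andP[_ wI] /eqP nw wv' nv'w.
have nwE z : z \in v |: I -> adj w z = (z == u).
  by move=> zI; have := in_set1 z u; rewrite -nw inE zI.
exists w.
  rewrite /blocks wI wv' nv'w !andbT; apply/eqP/setP => z.
  rewrite !inE; have [zI|zI] := boolP (z \in I).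
    by rewrite nwE // setU1r.
  by apply/esym/negbTE; apply: contraNneq zI => ->.
by rewrite adj_sym nwE ?setU11 //; apply: contraNneq vI => ->.
Qed.

(** Here [U] is the common neighbourhood of [v] and [v'] in [I], and [w u] the
    private neighbour of [u] that neither [v] nor [v'] sees. If the [w u] are
    independent, they replace [U] together with [v']; if not, freeness leaves
    only two vertices in [U], and [v], [v'] and one [w a] replace them. *)
Lemma no_twin_undefended v v' (U : {set G}) (w : G -> G) :
  v \notin I -> v' \notin I -> v' != v -> ~~ adj v v' ->
  nbrs I v = U -> nbrs I v' = U -> 1 < #|U| ->
  ~ (forall u, u \in U -> blocks I v' u (w u) /\ ~~ adj v (w u)).
Proof.
move=> vI v'I v'v nvv' nv nv' U_gt1 wP.
have UI : U \subset I by apply/subsetP => u; rewrite -nv => /nbrsP[].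
have nw u : u \in U -> nbrs I (w u) = [set u].
  by move=> /wP[/and4P[_ /eqP]].
have wI u : u \in U -> w u \notin I by move=> /wP[/and4P[]].
have wv' u : u \in U -> w u != v' by move=> /wP[/and4P[]].
have nv'w u : u \in U -> ~~ adj v' (w u) by move=> /wP[/and4P[]].
have nvw u : u \in U -> ~~ adj v (w u) by move=> /wP[].
have w_inj : {in U &, injective w}.
  by move=> a b aU bU wab; apply: set1_inj; rewrite -!nw // wab.
have [/independentP indW|] := boolP (independent (w @: U)).
  have : #|v' |: w @: U| <= #|U|.
    apply: exchange => //.
    - apply/independentP => x y /setU1P[->|xW] /setU1P[->|yW].
      + by rewrite adj_irrefl.
      + by case/imsetP: yW => b bU ->; apply: nv'w.
      + by case/imsetP: xW => a aU ->; rewrite adj_sym nv'w.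
      + exact: indW.
    - apply/pred0Pn => -[x /= /andP[/setU1P[->|/imsetP[a aU ->]]]].
        exact/negP.
      by apply/negP/wI.
    - move=> t /setU1P[->|/imsetP[a aU ->]]; first by rewrite nv'.
      by rewrite nw // sub1set.
  rewrite cardsU1 card_in_imset //.
  have -> : v' \notin w @: U.
    by apply/imsetP => -[a aU v'w]; have := wv' a aU; rewrite -v'w eqxx.
  by rewrite add1n ltnn.
move=> /forall_inPn[_ /imsetP[a aU ->]].
move=> /forall_inPn[_ /imsetP[b bU ->]]; rewrite negbK => wab.
have [Uab|] := boolP (U \subset [set a; b]).
  have : #|[set v'; v; w a]| <= #|U|.
    apply: exchange => //.
    - have [e1 e2] := (nvw a aU, nv'w a aU).
      apply/independentP => x y; rewrite !inE.
      by do 2![case/orP=> [/orP[]|] /eqP->];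
        rewrite ?adj_irrefl // adj_sym.
    - apply/pred0Pn => -[x /= /andP[]]; rewrite !inE.
      by case/orP=> [/orP[]|] /eqP->; apply/negP => //; apply: wI.
    - move=> t; rewrite !inE.
      by case/orP=> [/orP[]|] /eqP->; rewrite ?nv ?nv' // nw // sub1set.
  have vwa : v != w a.
    by apply/eqP => vwa; move: U_gt1; rewrite -nv vwa nw // cards1.
  have v'wa : v' != w a by rewrite eq_sym wv'.
  have := subset_leq_card Uab.
  rewrite cards2 => Uab2 /leq_trans/(_ Uab2).
  rewrite -setUA cardsU1 cards2 !inE (negbTE v'v) (negbTE v'wa) vwa.
  by case: (a != b).
(* A third vertex [c] of [U] sees neither [w a] nor [w b], both private to
   others, so the path [v, c, v'] is separated from the edge [w a, w b]. *)
move=> /subsetPn[c cU]; rewrite !inE negb_or => /andP[ca cb].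
have cw d : d \in U -> c != d -> ~~ adj c (w d).
  move=> dU; apply: contra => cwd.
  have : c \in nbrs I (w d).
    by apply/nbrsP; rewrite (subsetP UI) // adj_sym.
  by rewrite nw // in_set1.
have /nbrsP[_ vc] : c \in nbrs I v by rewrite nv.
have /nbrsP[_ v'c] : c \in nbrs I v' by rewrite nv'.
have cv' : adj c v' by rewrite adj_sym.
have vv' : v != v' by rewrite eq_sym.
have := P3_P2_free_adj free vc cv' vv' nvv' wab.
by rewrite /allrel /= !nvw // !nv'w // !cw.
Qed.

(** The choice of [v] turns the inclusion of neighbourhoods given by
    [far_private_adj] into an equality. *)
Lemma add_minimal_undefended v : undefended I v ->
  (forall u, undefended I u -> #|nbrs I v| <= #|nbrs I u|) ->
  secure_dominating (v |: I).
Proof.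
move=> und minv; have /undefendedP[vI _] := und.
have dom : dominating (v |: I).
  apply/dominatingP => x; rewrite in_setU1 negb_or => /andP[_ xI].
  have [z /nbrsP[zI xz]] := dominatingP _ max_independent_dominating x xI.
  by exists z; apply/nbrsP; rewrite setU1r.
apply: dominating_secure => // v'; apply/negP => und'.
have [v'I v'v nvv' bl] := undefended_add vI und'.
have undI : undefended I v'.
  by apply/undefendedP; split=> // u /bl[w]; exists w.
have sub : nbrs I v' \subset nbrs I v.
  apply/subsetP => x xv'; have [w /and4P[_ /eqP nw _ _] nvw] := bl x xv'.
  have /nbrsP[xI _] := xv'.
  by apply: contraNT nvw => xv; apply: far_private_adj nw.
have nv' : nbrs I v' = nbrs I v.
  by apply/eqP; rewrite eqEcard sub minv.
have [a [b [av bv ab]]] := undefended_two_nbrs und.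
have [w wP] : exists w : G -> G, forall u, u \in nbrs I v ->
    blocks I v' u (w u) /\ ~~ adj v (w u).
  apply: (@fin_all_exists _ _ (fun u w => u \in nbrs I v ->
    blocks I v' u w /\ ~~ adj v w)) => u.
  rewrite -nv'; have [/bl[w w1 w2]|uv] := boolP (u \in nbrs I v').
    by exists w.
  by exists u.
have U_gt1 : 1 < #|nbrs I v| by apply/card_gt1P; exists a, b.
exact: (no_twin_undefended vI v'I v'v nvv' (erefl _) nv' U_gt1 wP).
Qed.

End MaximumIndependent.
End SecureDomination.

(** * The bound *)

Theorem theorem6 (G : sgraph)
    (hG : graph_free (dunion (path_graph 3) (path_graph 2)) G) :
  secure_domination_number G <= independence_number G + 1.
Proof.
have [I indI maxI] := max_independent G.
have dom := max_independent_dominating indI maxI.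
have [/existsP[v0 und0]|/existsPn def] :=
  boolP [exists v, undefended I v]; last first.
  rewrite -maxI (leq_trans _ (leq_addr _ _)) //.
  exact: secure_domination_number_le (dominating_secure dom def).
have [v und minv] := arg_minnP (fun v => #|nbrs I v|) und0.
have sec := add_minimal_undefended indI maxI hG und minv.
apply: leq_trans (secure_domination_number_le sec) _.
by rewrite cardsU1 -maxI addnC leq_add2l leq_b1.
Qed.
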